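(* Consider the Retrospective Approximation (RA) iterates $\{X_k,k\ge1\}$ with sample sizes $\{M_k\}$ and error tolerances $\{\epsilon_k\}$, as described in the context. Suppose that: (i) as $k\to\infty$, $M_k\to\infty$ almost surely and $\mathbb{E}[\epsilon_k\mid\mathcal{F}_{k-1}]\to0$ almost surely; $\sup_{x\in\mathbb{R}^d}\|R_m(x)\|\to0$ almost surely as $m\to\infty$; $\mathbb{E}[G^2(Y)]<\infty$; and $\sup_k\mathbb{E}[\|\nabla f(X_k)\|^2\mid\mathcal{F}_{k-1}]\le\ell_{2,\infty}^2$ for a constant $\ell_{2,\infty}<\infty$; (ii) for each $k\ge1$, $\epsilon_k=C_{2,k}/M_k^{1/2}$, where $C_{2,k}$ is $\mathcal{F}_{k-1}$-measurable and $C_{2,k}\le c_2$ for a constant $c_2$; (iii) there exists $\sigma<\infty$ such that for every $k\ge 1$, $\mathbb{E}\left[\left(\sqrt{M_k}\,G_{M_k}\right)^2\mid\mathcal{F}_{k-1}\right]\le\sigma^2$. Then for every $k\ge1$, $$\mathbb{E}\left[\|\nabla f(X_k)\|\mid\mathcal{F}_{k-1}\right]\le\frac{c_2}{M_k^{1/2}}+\frac{c_0\sigma+\ell_{2,\infty}\sigma}{\sqrt{M_k}}.$$ If, moreover, $M_1=m_1$ is a positive constant and, for $k\ge2$, $M_k=C_{1,k}M_{k-1}$ with $C_{1,k}$ being $\mathcal{F}_{k-1}$-measurable and $C_{1,k}\ge c_1$ for a constant $c_1>1$, then for every $k\ge1$, $$\mathbb{E}\left[\|\nabla f(X_k)\|\right]\le\left(\frac1{\sqrt{c_1}}\right)^{k-1}\frac{c_2+c_0\sigma+\ell_{2,\infty}\sigma}{\sqrt{m_1}}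 .$$ Furthermore, for every $\epsilon>0$ and every $k\ge K(\epsilon)$, where $$K(\epsilon):=1+\frac1{\log\sqrt{c_1}}\left(\log\frac1\epsilon+\log\frac{c_2+c_0\sigma+\ell_{2,\infty}\sigma}{\sqrt{m_1}}\right),$$ one has $\mathbb{E}\left[\|\nabla f(X_k)\|\mid\mathcal{F}_{k-1}\right]\le\epsilon$.
   Context: Problem: minimize $f(x):=\mathbb{E}[F(x,Y)]$ over $x\in\mathbb{R}^d$, where $Y$ is a random variable with distribution $P$ on a measurable space $(\mathcal{Y},\mathcal{A})$, $F(\cdot,y)$ is a smooth function on $\mathbb{R}^d$ for every $y\in\mathcal{Y}$ with gradient $\nabla F(\cdot,y)$, and $\mathbb{E}[\nabla F(x,Y)]=\nabla f(x)$ for all $x$. $\|\cdot\|$ is the Euclidean norm. Sampling: $\{\tilde Y_j, j\ge1\}$ is an IID sequence of copies of $Y$. $M_1$ is a constant positive integer, $\mathcal{F}_0$ is trivial, $\mathcal{F}_k:=\sigma(\tilde Y_j: j\le \sum_{i=1}^k M_i)$, and the (positive-integer-valued) sample size $M_{k+1}$ is $\mathcal{F}_k$-measurable. At iteration $k$ the sample-path function and gradient are $$f_{M_k}(x):=\frac1{M_k}\sum_{j=1}^{M_k}F(x,Y_j),\qquad \nabla f_{M_k}(x):=\frac1{M_k}\sum_{j=1}^{M_k}\nabla F(x,Y_j),\qquad Y_j:=\tilde Y_{(\sum_{i=1}^{k-1}M_i)+j}.$$ RA algorithm: start from an initial guess $X_0$. At each outer iteration $k\ge1$, choose $M_k$ and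 a tolerance $\epsilon_k\ge0$, both $\mathcal{F}_{k-1}$-measurable; starting at $X_{k-1}$, run an iterative deterministic solver on the problem of minimizing $f_{M_k}$ over $\mathbb{R}^d$ until it produces a point $X_k$ with $\|\nabla f_{M_k}(X_k)\|\le\epsilon_k$. (It is assumed that the solver can always produce such a point.) Thus $X_k$ is $\mathcal{F}_k$-measurable. Relative error: fix $c_0>0$. $R(x,Y):=\frac{\nabla F(x,Y)-\nabla f(x)}{\|\nabla f(x)\|+c_0}$, with envelope $G(Y):=\sup_{x\in\mathbb{R}^d}\|R(x,Y)\|$. For $m\ge1$, $R_m(x):=\frac{\nabla f_m(x)-\nabla f(x)}{\|\nabla f(x)\|+c_0}$ with $\nabla f_m(x)=\frac1m\sum_{j=1}^m\nabla F(x,Y_j)$ and $Y_1,Y_2,\dots$ IID copies of $Y$; the empirical-mean envelope is $G_m:=\sup_{x\in\mathbb{R}^d}\|R_m(x)\|$. $G_{M_k}$ denotes the same quantity formed with $\nabla f_{M_k}$, i.e. with the iteration-$k$ sample. *)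

(* Defs.v *)
(* MathComp-Analysis *)
From HB Require Import structures.
From mathcomp Require Import all_boot all_order all_algebra.
From mathcomp Require Import all_classical all_reals all_analysis.
From mathcomp Require Import measurable_realfun.

Set Implicit Arguments.
Unset Strict Implicit.
Unset Printing Implicit Defensive.

Import Order.TTheory GRing.Theory Num.Theory.
Import numFieldNormedType.Exports.

Local Open Scope classical_set_scope.
Local Open Scope ring_scope.

(* The library's norm on ['rV_d] is the sup norm. *)
Definition enorm (R : realType) (d : nat) (x : 'rV[R]_d) : R :=
  Num.sqrt (\sum_(i < d) x 0 i ^+ 2).

Definition grad (R : realType) (d : nat) (g : 'rV[R]_d -> R) (x : 'rV[R]_d)
    : 'rV[R]_d :=
  \row_(i < d) 'D_(delta_mx 0 i) g x.

(* "Smooth" is read as continuously differentiable. *)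
Definition smooth (R : realType) (d : nat) (g : 'rV[R]_d -> R) : Prop :=
  (forall x, differentiable g x) /\ continuous (grad g).

Section Probability.
Context (R : realType) (dT dU : measure_display).
Context (T : measurableType dT) (U : measurableType dU).

(* Families indexed by the integers [j >= 1]; the value at [0] is irrelevant. *)
Definition mutually_independent (P : probability T R) (Y : nat -> T -> U)
    : Prop :=
  forall (J : seq nat) (B : nat -> set U),
    uniq J -> (forall j, j \in J -> (1 <= j)%N) ->
    (forall j, measurable (B j)) ->
    P (\bigcap_(j in [set` J]) (Y j @^-1` B j)) =
      (\prod_(j <- J) P (Y j @^-1` B j))%E.

Definition iid (P : probability T R) (PY : probability U R)
    (Y : nat -> T -> U) : Prop :=
  [/\ forall j, (1 <= j)%N -> measurable_fun setT (Y j),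
      forall j (B : set U), (1 <= j)%N -> measurable B ->
        P (Y j @^-1` B) = PY B
    & mutually_independent P Y].

Definition measurable_wrt (dV : measure_display) (V : measurableType dV)
    (G : set (set T)) (Z : T -> V) : Prop :=
  forall B : set V, measurable B -> G (Z @^-1` B).

(* Versions of E[X | G], for a nonnegative random variable [X] and a
   sub-sigma-algebra [G]; no integrability is required. *)
Definition is_cond_exp (P : probability T R) (G : set (set T))
    (X Z : T -> \bar R) : Prop :=
  [/\ measurable_fun setT X,
      measurable_wrt G Z,
      forall w, (0 <= Z w)%E
    & forall A, G A -> (\int[P]_(w in A) Z w = \int[P]_(w in A) X w)%E].

(* A chosen version of E[X | G] (unique up to a null set).  If [X] has no
   version, e.g. because it is not measurable, the value is +oo, so that no
   finite upper bound on [cond_exp P G X] can hold by default. *)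
Definition cond_exp (P : probability T R) (G : set (set T))
    (X : T -> \bar R) : T -> \bar R :=
  xget (cst +oo%E) [set Z | is_cond_exp P G X Z].

End Probability.

Section Problem.
Context (R : realType) (d : nat) (dU : measure_display).
Context (U : measurableType dU) (PY : probability U R).
Context (F : 'rV[R]_d -> U -> R) (c0 : R).

Definition objective (x : 'rV[R]_d) : R := \int[PY]_y F x y.

Definition gradF (x : 'rV[R]_d) (y : U) : 'rV[R]_d := grad (F ^~ y) x.

(* Standing assumptions on [F], including the integrability needed for the
   expectations defining [f] and equated to its gradient to make sense. *)
Definition smooth_problem : Prop :=
  [/\ forall y, smooth (F ^~ y),
      forall x, PY.-integrable setT (fun y => (F x y)%:E),
      forall x, differentiable objective x
    & forall x i,
        PY.-integrable setT (fun y => (gradF x y 0 i)%:E) /\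
        \int[PY]_y gradF x y 0 i = grad objective x 0 i].

Definition relerr (x : 'rV[R]_d) (y : U) : 'rV[R]_d :=
  (enorm (grad objective x) + c0)^-1 *: (gradF x y - grad objective x).

Definition envelope (y : U) : \bar R :=
  ereal_sup [set (enorm (relerr x y))%:E | x in [set: 'rV[R]_d]].

(* Samples [y 1, ..., y m] are indexed from 1. *)
Definition sample_fun (m : nat) (y : nat -> U) (x : 'rV[R]_d) : R :=
  m%:R^-1 * \sum_(1 <= j < m.+1) F x (y j).

Definition sample_grad (m : nat) (y : nat -> U) (x : 'rV[R]_d) : 'rV[R]_d :=
  m%:R^-1 *: \sum_(1 <= j < m.+1) gradF x (y j).

Definition sample_relerr (m : nat) (y : nat -> U) (x : 'rV[R]_d) : 'rV[R]_d :=
  (enorm (grad objective x) + c0)^-1 *: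
    (sample_grad m y x - grad objective x).

Definition sample_envelope (m : nat) (y : nat -> U) : \bar R :=
  ereal_sup [set (enorm (sample_relerr m y x))%:E | x in [set: 'rV[R]_d]].

End Problem.

Section RetrospectiveApproximation.
Context (R : realType) (d : nat) (dT dU : measure_display).
Context (T : measurableType dT) (U : measurableType dU).
Context (F : 'rV[R]_d -> U -> R) (Yt : nat -> T -> U) (M : nat -> T -> nat).

Definition total_sample (k : nat) (w : T) : nat :=
  (\sum_(1 <= i < k.+1) M i w)%N.

(* The sigma-algebra of the [Yt j] with [1 <= j <= total_sample k]: as this
   index range is random, [Yt j] contributes its events restricted to
   [{j <= total_sample k}].  For [k = 0] it is trivial. *)
Definition filtration (k : nat) : set (set T) :=
  <<s [set A | exists j (B : set U), [/\ (1 <= j)%N, measurable B &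
         A = [set w | (j <= total_sample k w)%N /\ B (Yt j w)]] ] >>.

Definition iter_sample (k : nat) (w : T) (j : nat) : U :=
  Yt (total_sample k.-1 w + j)%N w.

(* [solver g x] is the sequence of points produced by the deterministic solver
   applied to [g] from the starting point [x]; [X k] is the first of them that
   meets the tolerance.  [M] and [eps] are used for indices [k >= 1] only. *)
Record RA_iterates (m1 : nat)
    (solver : ('rV[R]_d -> R) -> 'rV[R]_d -> nat -> 'rV[R]_d)
    (eps : nat -> T -> R) (X : nat -> T -> 'rV[R]_d) : Prop := {
  RA_m1 : (0 < m1)%N;
  RA_M1 : forall w, M 1%N w = m1;
  RA_Mpos : forall k w, (1 <= k)%N -> (0 < M k w)%N;
  RA_Mmeas : forall k, (1 <= k)%N -> measurable_wrt (filtration k.-1) (M k);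
  RA_eps_ge0 : forall k w, (1 <= k)%N -> 0 <= eps k w;
  RA_eps_meas : forall k, (1 <= k)%N ->
    measurable_wrt (filtration k.-1) (eps k);
  RA_Xmeas : forall k i,
    measurable_wrt (filtration k) (fun w => X k w 0 i);
  RA_step : forall k w, (1 <= k)%N ->
    let g := sample_fun F (M k w) (iter_sample k w) in
    let Dg := sample_grad F (M k w) (iter_sample k w) in
    exists n : nat,
      [/\ X k w = solver g (X k.-1 w) n,
          enorm (Dg (X k w)) <= eps k w
        & forall n' : nat, (n' < n)%N ->
            eps k w < enorm (Dg (solver g (X k.-1 w) n'))]
}.

End RetrospectiveApproximation.

(* Main.v *)
Require Import Defs.
From HB Require Import structures.
From mathcomp Require Import all_boot all_order all_algebra.
From mathcomp Require Import all_classical all_reals all_analysis.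
From mathcomp Require Import measurable_realfun.
From mathcomp Require Import ring lra.

Set Implicit Arguments.
Unset Strict Implicit.
Unset Printing Implicit Defensive.

Import Order.TTheory GRing.Theory Num.Theory.
Import numFieldNormedType.Exports.

Local Open Scope classical_set_scope.
Local Open Scope ring_scope.

(** Write [N] for the norm of the true gradient at [X_k], [G] for the envelope
of the relative error of the iteration-[k] sample and [m] for the sample size
[M_k].  The solver stops with a sample gradient of norm at most
[c2 / sqrt m], and by definition of [G] the sample gradient differs from the
true one by at most [G * (N + c0)], so [N] satisfies the self-bound
[N <= c2 / sqrt m + c0 * G + G * N] ([grad_le_sample_envelope]).  Conditionally
on the past, [sqrt m * G] has second moment at most [sigma ^ 2] and [N] has
second moment at most [l ^ 2], so Cauchy-Schwarz bounds the conditional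
expectation of the right-hand side by
[(c2 + c0 * sigma + l * sigma) / sqrt m].  The other two conclusions follow,
since [M_k >= c1 ^ (k - 1) * m1] almost surely.

Cauchy-Schwarz is applied to unconditional integrals.  The sample size is known
given the past and takes countably many values, so a bound on the conditional
expectation depending on [M_k] only follows from integral bounds over the events
of the past on which [M_k] is constant ([cond_exp_le_on_atoms]).  On such an
event the products [c0 * G] and [G * N] are split by Young's inequality with
optimal weights ([integral_self_bounded_le]).

The gradient norm must also have a conditional expectation at all.  It is
obtained as a Radon-Nikodym derivative on the sub-sigma-algebra
([cond_exp_exists]); for the quantities appearing in the hypotheses, existence
follows from their almost sure upper bounds, because the default value of
[cond_exp] is infinite ([cond_exp_version_le]). *)

(** * The Euclidean norm *)

Section Enorm.
Context (R : realType) (d : nat).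
Implicit Types x y : 'rV[R]_d.

Lemma enorm_ge0 x : 0 <= enorm x.
Proof. exact: sqrtr_ge0. Qed.

Lemma enormN x : enorm (- x) = enorm x.
Proof. by rewrite /enorm; under eq_bigr do rewrite mxE sqrrN. Qed.

Lemma enorm_sqr x : enorm x ^+ 2 = \sum_(i < d) x 0 i ^+ 2.
Proof. by rewrite sqr_sqrtr// sumr_ge0// => i _; exact: sqr_ge0. Qed.

Lemma enormZ (a : R) x : 0 <= a -> enorm (a *: x) = a * enorm x.
Proof.
move=> a0; rewrite /enorm; under eq_bigr do rewrite mxE exprMn.
by rewrite -mulr_sumr sqrtrM ?sqr_ge0// sqrtr_sqr ger0_norm.
Qed.

Lemma enorm0_eq0 x : enorm x = 0 -> x = 0.
Proof.
move=> x0; have := enorm_sqr x; rewrite x0 expr0n => /esym/psumr_eq0P s0.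
apply/rowP => i; rewrite mxE; apply/eqP; rewrite -sqrf_eq0.
by apply/eqP/s0 => // j _; exact: sqr_ge0.
Qed.

(** The sum of the squares of [|y| * x_i - |x| * y_i] is nonnegative. *)
Lemma enorm_dot x y : \sum_(i < d) x 0 i * y 0 i <= enorm x * enorm y.
Proof.
have [/eqP/enorm0_eq0 ->|x0] := boolP (enorm x == 0).
  by rewrite big1 ?mulr_ge0 ?enorm_ge0// => i _; rewrite mxE mul0r.
have [/eqP/enorm0_eq0 ->|y0] := boolP (enorm y == 0).
  by rewrite big1 ?mulr_ge0 ?enorm_ge0// => i _; rewrite mxE mulr0.
have {}x0 : 0 < enorm x by rewrite lt_def x0 enorm_ge0.
have {}y0 : 0 < enorm y by rewrite lt_def y0 enorm_ge0.
set p := enorm x in x0 *; set q := enorm y in y0 *.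
have : 0 <= \sum_(i < d) (q * x 0 i - p * y 0 i) ^+ 2.
  by apply: sumr_ge0 => i _; exact: sqr_ge0.
rewrite (eq_bigr (fun i => q ^+ 2 * x 0 i ^+ 2 +
    - (2 * (p * q)) * (x 0 i * y 0 i) + p ^+ 2 * y 0 i ^+ 2)); last first.
  by move=> i _; ring.
rewrite !big_split/= -!mulr_sumr -!enorm_sqr -/p -/q => S0.
rewrite -(ler_pM2l (mulr_gt0 x0 y0)) -/p -/q; move: S0.
by set S := \sum_(i < d) _ => S0; lra.
Qed.

Lemma enormD x y : enorm (x + y) <= enorm x + enorm y.
Proof.
rewrite -ler_sqr ?nnegrE ?addr_ge0 ?enorm_ge0// sqrrD !enorm_sqr.
rewrite (eq_bigr (fun i => x 0 i ^+ 2 + x 0 i * y 0 i *+ 2 + y 0 i ^+ 2)).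
  rewrite !big_split/= lerD2r lerD2l mulr2n; apply: lerD; exact: enorm_dot.
by move=> i _; rewrite mxE sqrrD.
Qed.

End Enorm.

(** * Conditional expectation given a generated sigma-algebra *)

Section ConditionalExpectation.
Context (R : realType) (d : measure_display) (T : measurableType d).
Context (P : probability T R) (C : set (set T)).
Hypothesis Cm : C `<=` measurable.

Let subT := g_sigma_algebraType C.

Lemma sub_sigma_measurable A : <<s C>> A -> measurable A.
Proof. exact: (smallest_sub (@sigma_algebra_measurable _ T) Cm). Qed.

Lemma sub_sigma_setT : <<s C>> setT.
Proof. exact: (@measurableT _ subT). Qed.

Lemma measurable_wrt_fun {dV} {V : measurableType dV} (Z : T -> V) :
  measurable_wrt <<s C>> Z -> measurable_fun setT Z.
Proof.
by move=> mZ _ B mB; rewrite setTI; exact: sub_sigma_measurable (mZ _ mB).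
Qed.

(** The indefinite integral of [X], restricted to the sub-sigma-algebra, is a
finite measure dominated by the restriction of [P].  The latter is the law of
the identity map towards [T] equipped with the smaller sigma-algebra, which
turns the Radon-Nikodym density into a version of the conditional
expectation. *)
Lemma cond_exp_exists (X : T -> \bar R) :
  measurable_fun setT X -> (forall w, 0 <= X w)%E ->
  (\int[P]_w X w < +oo)%E -> exists Z, is_cond_exp P <<s C>> X Z.
Proof.
move=> mX X0 Xoo.
have mid : measurable_fun setT (id : T -> subT).
  by move=> _ A mA; rewrite setTI; exact: sub_sigma_measurable.
pose i : {mfun T >-> subT} := HB.pack (id : T -> subT)
  (isMeasurableFun.Build _ _ _ _ _ mid).
pose mu := distribution P i.
pose nu0 (A : set subT) : \bar R := (\int[P]_(w in A) X w)%E.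
have nu0_0 : nu0 set0 = 0%E by rewrite /nu0 integral_set0.
have nu0_ge0 A : (0 <= nu0 A)%E by apply: integral_ge0.
have nu0_sigma : semi_sigma_additive nu0.
  move=> A mA tA mUA; apply: (semi_sigma_additive_nng_induced mX X0) => //.
  - by move=> n; exact: sub_sigma_measurable (mA n).
  - exact: sub_sigma_measurable mUA.
have nu0_fin : fin_num_fun nu0.
  move=> A mA; rewrite ge0_fin_numE//; apply: le_lt_trans Xoo.
  by apply: ge0_subset_integral => //; exact: sub_sigma_measurable.
pose nuM := isMeasure.Build _ subT R nu0 nu0_0 nu0_ge0 nu0_sigma.
pose nu1 : {measure set subT -> \bar R} := HB.pack nu0 nuM.
pose nuF := Measure_isFinite.Build _ subT R nu1 nu0_fin.
pose nu := HB.pack_for (FiniteMeasure.type subT R) (Measure.sort nu1) nuF.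
have numu : nu `<< mu.
  apply/null_content_dominatesP => A mA muA0.
  apply: null_set_integral => //; first exact: sub_sigma_measurable.
  exact: measurable_funTS.
have [Z [Z0 Zfin Zint ZE]] := radon_nikodym_sigma_finite numu.
have mZ : measurable_fun setT Z by exact: measurable_int Zint.
exists Z; split => //.
  by move=> B mB; have := mZ measurableT B mB; rewrite setTI.
move=> A GA; apply: etrans (esym (ZE A GA)); apply/esym.
by apply: (ge0_integral_pushforward mid P GA) => //; exact: measurable_funTS.
Qed.

Lemma cond_exp_version (X Z : T -> \bar R) :
  is_cond_exp P <<s C>> X Z -> is_cond_exp P <<s C>> X (cond_exp P <<s C>> X).
Proof. by move=> ZX; exact: (xgetPex _ (ex_intro _ Z ZX)). Qed.

(** If there were no version, [cond_exp] would be identically [+oo], and a finite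
bound would fail on the whole space, which is not negligible. *)
Lemma cond_exp_version_le (X : T -> \bar R) (r : R) :
  {ae P, forall w, (cond_exp P <<s C>> X w <= r%:E)%E} ->
  is_cond_exp P <<s C>> X (cond_exp P <<s C>> X).
Proof.
move=> hr.
have [[Z /cond_exp_version//]|noZ] := pselect (exists Z, is_cond_exp P <<s C>> X Z).
have ZE : cond_exp P <<s C>> X = cst +oo%E.
  by apply: xgetPN => Z ZX; apply: noZ; exists Z.
have P0 : (0 < P setT)%E by rewrite probability_setT.
have [w] := @filter_ex _ _ (ae_properfilter_algebraOfSetsType P0) _ hr.
by rewrite ZE.
Qed.

Lemma integral_le_of_cond_exp_le (X Z : T -> \bar R) (r : R) (A : set T) :
  is_cond_exp P <<s C>> X Z -> 0 <= r ->
  {ae P, forall w, (Z w <= r%:E)%E} -> <<s C>> A ->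
  (\int[P]_(w in A) X w <= r%:E * P A)%E.
Proof.
move=> [mX GZ Z0 ZX] r0 Zr GA; have mA := sub_sigma_measurable GA.
rewrite -ZX// -integral_cst//; apply: ae_ge0_le_integral => //.
- exact/measurable_funTS/measurable_wrt_fun.
- by move: Zr; apply: filterS => w + _.
Qed.

(** The event [{Z > b m} `&` {M = m}] belongs to the sub-sigma-algebra, so the
assumption applies to it: the mean of [Z] over this event is at most [b m],
although [Z] exceeds [b m] there.  The event is therefore negligible, and there
are countably many of them. *)
Lemma cond_exp_le_on_atoms (X Z : T -> \bar R) (M : T -> nat) (b : nat -> R) :
  is_cond_exp P <<s C>> X Z -> measurable_wrt <<s C>> M ->
  (forall m, 0 <= b m) ->
  (forall m A, <<s C>> A -> A `<=` [set w | M w = m] ->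
     (\int[P]_(w in A) X w <= (b m)%:E * P A)%E) ->
  {ae P, forall w, (Z w <= (b (M w))%:E)%E}.
Proof.
move=> [mX GZ Z0 ZX] GM b0 Xb.
have mZ := measurable_wrt_fun GZ.
have bad m : {ae P, forall w, M w = m -> (Z w <= (b m)%:E)%E}.
  pose B : set subT := M @^-1` [set m] `&` Z @^-1` `]((b m)%:E), +oo[%classic.
  have GB : <<s C>> B.
    apply: (@measurableI _ subT); first exact: GM.
    by apply: GZ; exact: emeasurable_itv.
  have mB : measurable (B : set T) := sub_sigma_measurable GB.
  pose D w := (Z w - (b m)%:E)%E.
  have D0 w : (B : set T) w -> (0 <= D w)%E.
    move=> [_]/=; rewrite in_itv/= andbT => /ltW bZ.
    by rewrite /D sube_ge0.
  have mD : measurable_fun setT D by exact: emeasurable_funB.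
  have ZD : (\int[P]_(w in B) Z w = \int[P]_(w in B) D w + (b m)%:E * P B)%E.
    rewrite -integral_cst// -ge0_integralD//.
    - by apply: eq_integral => w _; rewrite /D subeK.
    - exact: measurable_funTS.
    - by move=> w _; rewrite lee_fin.
  have := Xb m _ GB (@subIsetl _ _ _); rewrite -ZX// ZD.
  have bPfin : ((b m)%:E * P B)%E \is a fin_num.
    by rewrite fin_numM// fin_num_measure.
  rewrite -[leRHS]add0e leeD2rE// => I0.
  have /ae_eq_integral_abs : (\int[P]_(w in B) `|D w| = 0)%E.
    rewrite (eq_integral D).
      by apply/eqP; rewrite eq_le I0 integral_ge0.
    by move=> w /set_mem Bw; rewrite gee0_abs// D0.
  move=> /(_ mB (measurable_funTS mD)); apply: filterS => w Dw Mw.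
  rewrite leNgt; apply/negP => bZ; have Bw : (B : set T) w.
    by split => //=; rewrite in_itv/= bZ.
  by have : (0 < D w)%E; [rewrite sube_gt0 | rewrite (Dw Bw) ltxx].
by move: (ae_foralln bad); apply: filterS => w /(_ _ erefl).
Qed.

End ConditionalExpectation.

(** * The filtration of the sampling scheme *)

Section Filtration.
Context (dT dU : measure_display).
Context (T : measurableType dT) (U : measurableType dU).
Context (Yt : nat -> T -> U) (M : nat -> T -> nat).

(** [filtration Yt M k] is by definition [<<s filtration_gen k>>]; naming the
generators makes the results on generated sigma-algebras applicable to it. *)
Definition filtration_gen (k : nat) : set (set T) :=
  [set A | exists j (B : set U), [/\ (1 <= j)%N, measurable B &
     A = [set w | (j <= total_sample M k w)%N /\ B (Yt j w)]] ].

Hypothesis mY : forall j, (1 <= j)%N -> measurable_fun setT (Yt j).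
Hypothesis mM : forall k, (1 <= k)%N ->
  measurable_wrt (filtration Yt M k.-1) (M k).

(** The generators involve the random index bound [total_sample M k], while the
measurability of [M k.+1] is only known relative to [filtration Yt M k].  The
two facts feed each other, by induction on [k]. *)
Lemma filtration_gen_measurable k : filtration_gen k `<=` measurable.
Proof.
have gen n : (forall j, measurable [set w | (j <= total_sample M n w)%N]) ->
    filtration_gen n `<=` measurable.
  move=> mS _ [j [B [j1 mB ->]]].
  apply: (@measurableI _ _ _ (Yt j @^-1` B)); first exact: mS.
  by rewrite -[X in measurable X]setTI; exact: mY.
suff mS n : measurable_fun setT (total_sample M n).
  apply: gen => j; rewrite -[X in measurable X]setTI.
  exact: (mS k measurableT [set i | (j <= i)%N]).
elim: n => [|n IHn].
  rewrite (_ : total_sample M 0 = cst 0%N); first exact: measurable_cst.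
  by apply/funext => w; rewrite /total_sample big_geq.
have mMn : measurable_fun setT (M n.+1).
  apply: (measurable_wrt_fun (C := filtration_gen n)); last exact: (mM (ltn0Sn n)).
  apply: gen => j; rewrite -[X in measurable X]setTI.
  exact: (IHn measurableT [set i | (j <= i)%N]).
rewrite (_ : total_sample M n.+1 = fun w => (total_sample M n w + M n.+1 w)%N).
  exact: measurable_fun_addn.
by apply/funext => w; rewrite /total_sample big_nat_recr.
Qed.

End Filtration.

(** * The self-bound on the gradient norm *)

Section SelfBound.
Context (R : realType).

Lemma grad_le_sample_envelope (d : nat) (dU : measure_display)
    (U : measurableType dU) (PY : probability U R)
    (F : 'rV[R]_d -> U -> R) (c0 : R) (m : nat) (y : nat -> U) (x : 'rV[R]_d) :
  0 < c0 ->
  ((enorm (grad (objective PY F) x))%:E <= (enorm (sample_grad F m y x))%:E +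
     sample_envelope PY F c0 m y *
       (enorm (grad (objective PY F) x) + c0)%:E)%E.
Proof.
move=> c0_gt0; set N := enorm _; set G := sample_envelope _ _ _ _ _.
have Nc0 : 0 < N + c0 by rewrite ltr_wpDl// enorm_ge0.
have relG : ((enorm (sample_relerr PY F c0 m y x))%:E <= G)%E.
  by apply: ereal_sup_ubound; exists x.
have -> : N%:E = (enorm (sample_grad F m y x -
    (sample_grad F m y x - grad (objective PY F) x)))%:E by rewrite subKr.
apply: (@le_trans _ _ ((enorm (sample_grad F m y x))%:E +
    (enorm (sample_relerr PY F c0 m y x) * (N + c0))%:E)%E).
  rewrite -EFinD lee_fin (le_trans (enormD _ _))// enormN lerD2l.
  rewrite enormZ ?invr_ge0 ?(ltW Nc0)// mulrAC mulVf ?gt_eqF//.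
  by rewrite mul1r.
by rewrite leeD2l// EFinM lee_wpmul2r// lee_fin ltW.
Qed.

Lemma sample_envelope_ge0 (d : nat) (dU : measure_display)
    (U : measurableType dU) (PY : probability U R)
    (F : 'rV[R]_d -> U -> R) (c0 : R) (m : nat) (y : nat -> U) :
  (0 <= sample_envelope PY F c0 m y)%E.
Proof.
apply: (@le_trans _ _ (enorm (sample_relerr PY F c0 m y 0))%:E).
  by rewrite lee_fin enorm_ge0.
by apply: ereal_sup_ubound; exists 0.
Qed.

(** With [h := q * G], the products [h * c0] and [h * N] are split as
[c0 * (h ^ 2 / s + s) / 2] and [(t / s * h ^ 2 + s / t * N ^ 2) / 2].  When
[s ^ 2] and [t ^ 2] bound the means of [h ^ 2] and [N ^ 2], these bounds
integrate to [c0 * s] and [t * s], which is what Cauchy-Schwarz gives. *)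
Lemma young_self_bound (N q s t c c0 : R) (G : \bar R) :
  0 < q -> 0 < s -> 0 < t -> 0 < c0 -> 0 <= N -> (0 <= G)%E ->
  (N%:E <= (c / q)%:E + G * (N + c0)%:E)%E ->
  (N%:E <= ((c + c0 * s / 2) / q)%:E +
     (((c0 + t) / s) / (2 * q))%:E * (q%:E * G) ^+ 2 +
     (s / (2 * q * t))%:E * (N ^+ 2)%:E)%E.
Proof.
move=> q0 s0 t0 c00 N0; case: G => [g|_ _|//]; last first.
  rewrite mulry gtr0_sg// mul1e expe2 mulyy.
  rewrite gt0_muley ?lte_fin ?divr_gt0 ?addr_gt0 ?mulr_gt0//.
  by rewrite addey// leey.
rewrite lee_fin => g0; rewrite -!EFinM -!EFinD !lee_fin => Nle.
have h0 : 0 <= q * g by rewrite mulr_ge0// ltW.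
set h := q * g in h0 *.
have qN : q * N <= c + h * (N + c0).
  by rewrite -(ler_pM2l q0) mulrDr mulrCA mulfV ?gt_eqF// mulr1 mulrA in Nle.
have hc : h * c0 <= c0 * s / 2 + c0 / s * (h ^+ 2) / 2.
  rewrite -subr_ge0 (_ : _ - _ = c0 / (2 * s) * (h - s) ^+ 2).
    by rewrite mulr_ge0 ?sqr_ge0 ?divr_ge0 ?mulr_ge0 ?ltW.
  by field; rewrite gt_eqF.
have hN : h * N <= t / s * h ^+ 2 / 2 + s / t * N ^+ 2 / 2.
  rewrite -subr_ge0 (_ : _ - _ = (t * h - s * N) ^+ 2 / (2 * s * t)).
    by rewrite divr_ge0 ?sqr_ge0 ?mulr_ge0 ?ltW.
  by field; rewrite !gt_eqF.
rewrite -(ler_pM2l q0); apply: le_trans qN _.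
have -> : q * ((c + c0 * s / 2) / q + (c0 + t) / s / (2 * q) * (h ^+ 2) +
  s / (2 * q * t) * N ^+ 2) =
  c + (c0 * s / 2 + c0 / s * (h ^+ 2) / 2) +
  (t / s * h ^+ 2 / 2 + s / t * N ^+ 2 / 2).
  by field; rewrite !gt_eqF.
by move: hc hN; lra.
Qed.

End SelfBound.

(** * Integrating the self-bound *)

Section IntegratedSelfBound.
Context (R : realType) (dT : measure_display) (T : measurableType dT).
Context (P : probability T R).

Lemma measurable_fun_of_sqr (A : set T) (N : T -> R) :
  (forall w, 0 <= N w) -> measurable_fun A (fun w => (N w ^+ 2)%:E) ->
  measurable_fun A N.
Proof.
move=> N0 mN2; rewrite (_ : N = Num.sqrt \o (fun w => N w ^+ 2)).
  apply: measurableT_comp; last exact/measurable_EFinP.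
  exact: (continuous_measurable_fun (@sqrt_continuous R)).
by apply/funext => w /=; rewrite sqrtr_sqr ger0_norm.
Qed.

Section Bound.
Variables (A : set T) (N : T -> R) (G : T -> \bar R) (q c c0 : R).
Hypothesis mA : measurable A.
Hypothesis mN2 : measurable_fun A (fun w => (N w ^+ 2)%:E).
Hypothesis mG2 : measurable_fun A (fun w => (q%:E * G w) ^+ 2)%E.
Hypothesis q_ge1 : 1 <= q.
Hypothesis c0_gt0 : 0 < c0.
Hypothesis c_ge0 : 0 <= c.
Hypothesis N_ge0 : forall w, 0 <= N w.
Hypothesis G_ge0 : forall w, (0 <= G w)%E.
Hypothesis NG : {ae P, forall w, A w ->
  ((N w)%:E <= (c / q)%:E + G w * (N w + c0)%:E)%E}.

Let q_gt0 : 0 < q. Proof. exact: lt_le_trans q_ge1. Qed.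

Let integral_self_bounded_le_pos (s t : R) : 0 < s -> 0 < t ->
  (\int[P]_(w in A) ((q%:E * G w) ^+ 2) <= (s ^+ 2)%:E * P A)%E ->
  (\int[P]_(w in A) (N w ^+ 2)%:E <= (t ^+ 2)%:E * P A)%E ->
  (\int[P]_(w in A) (N w)%:E <= ((c + (c0 + t) * s) / q)%:E * P A)%E.
Proof.
move=> s_gt0 t_gt0 intG intN.
have mN := measurable_fun_of_sqr N_ge0 mN2.
(* The coefficients of [young_self_bound]. *)
pose a1 := (c + c0 * s / 2) / q; pose a2 := ((c0 + t) / s) / (2 * q).
pose a3 := s / (2 * q * t).
have [q_ge0 s_ge0 t_ge0 c0_ge0] : [/\ 0 <= q, 0 <= s, 0 <= t & 0 <= c0].
  by split; exact: ltW.
have a1_ge0 : 0 <= a1 by rewrite divr_ge0 ?addr_ge0 ?divr_ge0 ?mulr_ge0.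
have a2_ge0 : 0 <= a2 by rewrite 2?divr_ge0 ?(addr_ge0 c0_ge0 t_ge0)// mulr_ge0.
have a3_ge0 : 0 <= a3 by rewrite divr_ge0 ?mulr_ge0.
pose V w := ((q%:E * G w) ^+ 2)%E.
have V_ge0 w : (0 <= V w)%E by rewrite expe_ge0// mule_ge0// lee_fin ltW.
apply: (@le_trans _ _ (\int[P]_(w in A)
    (a1%:E + a2%:E * V w + a3%:E * (N w ^+ 2)%:E))%E).
  apply: ae_ge0_le_integral => //.
  - by move=> w _; rewrite lee_fin.
  - exact/measurable_EFinP.
  - by move=> w _; rewrite !adde_ge0 ?mule_ge0 ?lee_fin ?sqr_ge0.
  - apply: emeasurable_funD; last exact: measurable_funeM.
    by apply: emeasurable_funD => //; exact: measurable_funeM.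
  - move: NG; apply: filterS => w + Aw => /(_ Aw).
    exact: young_self_bound.
rewrite ge0_integralD//; last 4 first.
  - by move=> w _; rewrite adde_ge0 ?mule_ge0 ?lee_fin.
  - by apply: emeasurable_funD => //; exact: measurable_funeM.
  - by move=> w _; rewrite mule_ge0 ?lee_fin ?sqr_ge0.
  - exact: measurable_funeM.
rewrite ge0_integralD//; last 2 first.
  - by move=> w _; rewrite mule_ge0 ?lee_fin ?sqr_ge0.
  - exact: measurable_funeM.
rewrite !ge0_integralZl_EFin ?integral_cst//; last first.
  by move=> w _; rewrite lee_fin sqr_ge0.
apply: (@le_trans _ _ (a1%:E * P A + a2%:E * ((s ^+ 2)%:E * P A) +
    a3%:E * ((t ^+ 2)%:E * P A))%E).
  by apply: leeD; first apply: leeD => //; apply: lee_wpmul2l; rewrite ?lee_fin.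
have /fineK <- : P A \is a fin_num by exact: fin_num_measure.
rewrite -!EFinM -!EFinD lee_fin le_eqVlt; apply/orP; left; apply/eqP.
by rewrite /a1 /a2 /a3; field; rewrite !gt_eqF.
Qed.

(** The optimal Young weights [s = sigma] and [t = l] are excluded when one of
these constants vanishes, so the bound is a limit of the bounds for
[sigma + e] and [l + e] as [e] decreases to [0]. *)
Lemma integral_self_bounded_le (l sigma : R) : 0 <= l -> 0 <= sigma ->
  (\int[P]_(w in A) ((q%:E * G w) ^+ 2) <= (sigma ^+ 2)%:E * P A)%E ->
  (\int[P]_(w in A) (N w ^+ 2)%:E <= (l ^+ 2)%:E * P A)%E ->
  (\int[P]_(w in A) (N w)%:E <= ((c + (c0 + l) * sigma) / q)%:E * P A)%E.
Proof.
move=> l_ge0 sigma_ge0 intG intN.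
suff lim (e : R) : 0 < e -> (\int[P]_(w in A) (N w)%:E <=
    ((c + (c0 + l) * sigma) / q)%:E * P A + e%:E)%E by exact/lee_addgt0Pr.
move=> e_gt0.
pose B := c0 + l + sigma.
have B_ge0 : 0 <= B by rewrite !addr_ge0// ltW.
(* Shifting both constants by [dl <= 1] increases the bound by at most
   [dl * (dl + B) <= dl * (1 + B)]. *)
pose dl := Num.min 1 (e / (1 + B)).
have dl_gt0 : 0 < dl by rewrite lt_min ltr01 divr_gt0// ltr_pwDl.
have dl_le1 : dl <= 1 by rewrite ge_min lexx.
have dlB : dl * (1 + B) <= e.
  by rewrite -ler_pdivlMr ?ltr_pwDl// ge_min lexx orbT.
apply: (@le_trans _ _
    (((c + (c0 + (l + dl)) * (sigma + dl)) / q)%:E * P A)%E).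
  have shift (x : R) : 0 <= x -> ((x ^+ 2)%:E * P A <= ((x + dl) ^+ 2)%:E * P A)%E.
    move=> x_ge0; apply: lee_wpmul2r => //; rewrite lee_fin.
    by rewrite lerXn2r ?nnegrE ?addr_ge0 ?lerDl ?(ltW dl_gt0).
  apply: integral_self_bounded_le_pos; rewrite ?ltr_wpDl//.
    exact: le_trans intG (shift _ sigma_ge0).
  exact: le_trans intN (shift _ l_ge0).
have /fineK <- : P A \is a fin_num by exact: fin_num_measure.
have p_ge0 : 0 <= fine (P A) by exact: fine_ge0.
have p_le1 : fine (P A) <= 1.
  by rewrite -lee_fin fineK ?fin_num_measure// probability_le1.
move: (fine (P A)) p_ge0 p_le1 => p p_ge0 p_le1.
rewrite -!EFinM -EFinD lee_fin -lerBlDl -mulrBl -mulrBl.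
have -> : c + (c0 + (l + dl)) * (sigma + dl) - (c + (c0 + l) * sigma) =
    dl * (dl + B) by rewrite /B; ring.
have qV_le1 : q^-1 <= 1 by rewrite invf_le1.
have qV_ge0 : 0 <= q^-1 by rewrite invr_ge0 ltW.
have qp_le1 : q^-1 * p <= 1 by exact: mulr_ile1.
have dlB' : dl * (dl + B) <= dl * (1 + B) by rewrite ler_pM2l// lerD2r.
have dlB_ge0 : 0 <= dl * (dl + B).
  by exact: (mulr_ge0 (ltW dl_gt0) (addr_ge0 (ltW dl_gt0) B_ge0)).
rewrite -(mulrA _ q^-1 p); apply: le_trans dlB; apply: le_trans dlB'.
by rewrite ler_piMr.
Qed.

End Bound.

End IntegratedSelfBound.

(** * Geometric growth of the sample size *)

(** The condition on [k] is the logarithm of the conclusion; for [L = 0] it reads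
[-oo <= k] and the conclusion is trivial. *)
Lemma geometric_decay_le (R : realType) (c1 L e : R) (k : nat) :
  1 < c1 -> 0 < e -> 0 <= L -> (1 <= k)%N ->
  (1 + ((ln (Num.sqrt c1))^-1)%:E * (lne (e^-1)%:E + lne L%:E)
     <= (k%:R : R)%:E)%E ->
  (Num.sqrt c1)^-1 ^+ k.-1 * L <= e.
Proof.
move=> c1_gt1 e0 + k1; set s := Num.sqrt c1.
have s1 : 1 < s by rewrite -[ltLHS]sqrtr1 ltr_sqrt// (lt_trans _ c1_gt1).
have s0 : 0 < s by exact: lt_trans s1.
have lns : 0 < ln s by rewrite ln_gt0.
rewrite le_eqVlt => /predU1P[<- _|L0]; first by rewrite mulr0 ltW.
rewrite !lne_EFin ?invr_gt0//.
rewrite -[X in (_ * X)%E]EFinD -EFinM -EFinD lee_fin.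
rewrite lnV ?posrE// addrC -lerBrDr mulrC ler_pdivrMr// => hk.
rewrite exprVn mulrC ler_pdivrMr ?exprn_gt0//.
rewrite -ler_ln ?posrE ?mulr_gt0 ?exprn_gt0// lnM ?posrE ?exprn_gt0// lnXn//.
have -> : ln s *+ k.-1 = (k%:R - 1) * ln s.
  by rewrite -{2}(prednK k1) mulrSr addrK mulr_natl.
by move: hk; set p := _ * ln s => hk; lra.
Qed.

(** * Gradient bounds along the iterates *)

Theorem theorem3 (R : realType) (d : nat)
    (dT dU : measure_display) (T : measurableType dT) (U : measurableType dU)
    (P : probability T R) (PY : probability U R)
    (F : 'rV[R]_d -> U -> R) (c0 : R)
    (Yt : nat -> T -> U) (m1 : nat) (M : nat -> T -> nat)
    (solver : ('rV[R]_d -> R) -> 'rV[R]_d -> nat -> 'rV[R]_d)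
    (eps : nat -> T -> R) (X : nat -> T -> 'rV[R]_d)
    (l sigma c2 : R) (C2 : nat -> T -> R)
    (hF : smooth_problem PY F) (hc0 : 0 < c0)
    (hY : iid P PY Yt)
    (hRA : RA_iterates F Yt M m1 solver eps X)
    (* (i) *)
    (hM : {ae P, forall w, M k w @[k --> \oo] --> \oo})
    (heps : {ae P, forall w,
       cond_exp P (filtration Yt M k.-1) (fun w' => (eps k w')%:E) w
         @[k --> \oo] --> (0 : \bar R)%E})
    (hR : {ae P, forall w,
       sample_envelope PY F c0 m (fun j => Yt j w)
         @[m --> \oo] --> (0 : \bar R)%E})
    (hG : PY.-integrable setT (fun y => envelope PY F c0 y ^+ 2)%E)
    (hl0 : 0 <= l)
    (hl : {ae P, forall w,
       (ereal_sup [set cond_exp P (filtration Yt M k.-1)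
            (fun w' => (enorm (grad (objective PY F) (X k w')) ^+ 2)%:E) w
          | k in [set k : nat | (1 <= k)%N]] <= (l ^+ 2)%:E)%E})
    (* (ii) *)
    (hC2 : forall k, (1 <= k)%N ->
       measurable_wrt (filtration Yt M k.-1) (C2 k))
    (hepsC2 : forall k, (1 <= k)%N ->
       {ae P, forall w, eps k w = C2 k w / Num.sqrt (M k w)%:R})
    (hC2c2 : forall k, (1 <= k)%N -> {ae P, forall w, C2 k w <= c2})
    (* (iii) *)
    (hs0 : 0 <= sigma)
    (hs : forall k, (1 <= k)%N -> {ae P, forall w,
       (cond_exp P (filtration Yt M k.-1)
          (fun w' => ((Num.sqrt (M k w')%:R)%:E *
             sample_envelope PY F c0 (M k w') (iter_sample Yt M k w')) ^+ 2) w
        <= (sigma ^+ 2)%:E)%E}) :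
  (forall k, (1 <= k)%N -> {ae P, forall w,
     (cond_exp P (filtration Yt M k.-1)
        (fun w' => (enorm (grad (objective PY F) (X k w')))%:E) w
      <= (c2 / Num.sqrt (M k w)%:R
          + (c0 * sigma + l * sigma) / Num.sqrt (M k w)%:R)%:E)%E})
  /\
  (forall (c1 : R) (C1 : nat -> T -> R),
     1 < c1 ->
     (forall k, (2 <= k)%N ->
        [/\ measurable_wrt (filtration Yt M k.-1) (C1 k),
            {ae P, forall w, c1 <= C1 k w}
          & {ae P, forall w, (M k w)%:R = C1 k w * (M k.-1 w)%:R}]) ->
     (forall k, (1 <= k)%N ->
        (\int[P]_w (enorm (grad (objective PY F) (X k w)))%:E
         <= ((Num.sqrt c1)^-1 ^+ k.-1 *
             ((c2 + c0 * sigma + l * sigma) / Num.sqrt m1%:R))%:E)%E)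
     /\
     (* [lne] is the extended logarithm, with [lne 0 = -oo] *)
     (forall (e : R) (k : nat), 0 < e -> (1 <= k)%N ->
        (1 + ((ln (Num.sqrt c1))^-1)%:E *
             (lne (e^-1)%:E +
              lne ((c2 + c0 * sigma + l * sigma) / Num.sqrt m1%:R)%:E)
         <= (k%:R : R)%:E)%E ->
        {ae P, forall w,
          (cond_exp P (filtration Yt M k.-1)
             (fun w' => (enorm (grad (objective PY F) (X k w')))%:E) w
           <= e%:E)%E})).
Proof.
pose N k w := enorm (grad (objective PY F) (X k w)).
pose V k w := ((Num.sqrt (M k w)%:R)%:E *
  sample_envelope PY F c0 (M k w) (iter_sample Yt M k w))%E.
pose K := c2 + c0 * sigma + l * sigma.
have N0 k w : 0 <= N k w by exact: enorm_ge0.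
have [mY _ _] := hY.
have Cm k : filtration_gen Yt M k `<=` measurable.
  apply: filtration_gen_measurable; first exact: mY.
  exact: (RA_Mmeas hRA).
(* The sign of [c2] comes from that of the tolerances: [0 <= eps 1] almost
   surely forces [0 <= C2 1 <= c2] at some point. *)
have c20 : 0 <= c2.
  have P0 : (0 < P setT)%E by rewrite probability_setT.
  have [w [epsE Cc]] := @filter_ex _ _ (ae_properfilter_algebraOfSetsType P0) _
    (filterI (hepsC2 1%N (leqnn 1)) (hC2c2 1%N (leqnn 1))).
  apply: le_trans Cc; have := RA_eps_ge0 hRA w (leqnn 1); rewrite epsE.
  by rewrite pmulr_lge0// invr_gt0 sqrtr_gt0 ltr0n (RA_Mpos hRA).
have K0 : 0 <= K by rewrite !addr_ge0 ?mulr_ge0// ltW.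
have KE : c2 + (c0 + l) * sigma = K by rewrite /K; ring.
have NG k : (1 <= k)%N -> {ae P, forall w, ((N k w)%:E <=
    (c2 / Num.sqrt (M k w)%:R)%:E +
    sample_envelope PY F c0 (M k w) (iter_sample Yt M k w) * (N k w + c0)%:E)%E}.
  move=> k1; move: (hepsC2 k k1) (hC2c2 k k1); apply: filterS2 => w epsE Cc.
  apply: le_trans (grad_le_sample_envelope PY F (M k w)
    (iter_sample Yt M k w) (X k w) hc0) _.
  apply: leeD => //; rewrite lee_fin.
  have [n [_ + _]] := RA_step hRA w k1; move=> /le_trans; apply.
  by rewrite epsE ler_wpM2r// invr_ge0 sqrtr_ge0.
have hlk k : (1 <= k)%N -> {ae P, forall w,
    (cond_exp P <<s filtration_gen Yt M k.-1>> (fun w' => (N k w' ^+ 2)%:E) w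
     <= (l ^+ 2)%:E)%E}.
  move=> k1; move: hl; apply: filterS => w; apply: le_trans.
  by apply: ereal_sup_ubound; exists k.
have Nver k k1 := cond_exp_version_le (hlk k k1).
have Vver k k1 := cond_exp_version_le (hs k k1).
have mN2 k : (1 <= k)%N -> measurable_fun setT (fun w => (N k w ^+ 2)%:E).
  by move=> /Nver[].
have mV k : (1 <= k)%N -> measurable_fun setT (fun w => V k w ^+ 2)%E.
  by move=> /Vver[].
have l20 : 0 <= l ^+ 2 by exact: sqr_ge0.
have s20 : 0 <= sigma ^+ 2 by exact: sqr_ge0.
(* On an event of the past where [M k] is constant, the random factor
   [sqrt (M k)] in the second moment bound on [V k] is a constant. *)
have localN k m A : (1 <= k)%N -> <<s filtration_gen Yt M k.-1>> A ->
    A `<=` [set w | M k w = m] ->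
    (\int[P]_(w in A) (N k w)%:E <= (K / Num.sqrt m%:R)%:E * P A)%E.
  move=> k1 GA AM; have mA := sub_sigma_measurable (Cm k.-1) GA.
  have [m0|m0] := posnP m.
    suff -> : A = set0 by rewrite integral_set0 measure0 mule0.
    rewrite -subset0 => w /AM /= Mw; have := RA_Mpos hRA w k1.
    by rewrite Mw m0.
  have VE w : A w -> V k w = ((Num.sqrt m%:R)%:E *
      sample_envelope PY F c0 (M k w) (iter_sample Yt M k w))%E.
    by move=> /AM /= Mw; rewrite /V Mw.
  rewrite -KE; apply: (@integral_self_bounded_le _ _ _ P A (N k)
    (fun w => sample_envelope PY F c0 (M k w) (iter_sample Yt M k w))) => //.
  - by apply: measurable_funTS; exact: mN2.
  - apply: (@eq_measurable_fun _ _ _ _ A (fun w => V k w ^+ 2)%E).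
      by move=> w /set_mem Aw; rewrite VE.
    by apply: measurable_funTS; exact: mV.
  - by rewrite -[leLHS]sqrtr1 ler_sqrt// ler1n.
  - by move=> w; exact: sample_envelope_ge0.
  - by move: (NG k k1); apply: filterS => w + /AM /= Mw; rewrite Mw.
  - rewrite (eq_integral (fun w => V k w ^+ 2)%E).
      exact: (integral_le_of_cond_exp_le (Cm k.-1) (Vver k k1) s20 (hs k k1) GA).
    by move=> w /set_mem Aw; rewrite VE.
  - exact: (integral_le_of_cond_exp_le (Cm k.-1) (Nver k k1) l20 (hlk k k1) GA).
have mN k : (1 <= k)%N -> measurable_fun setT (fun w => (N k w)%:E).
  by move=> k1; apply/measurable_EFinP/measurable_fun_of_sqr => //; exact: mN2.
(* Cauchy-Schwarz against the constant function [1], read as the trivial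
   self-bound [N <= 1 * (N + 1)]. *)
have intN k : (1 <= k)%N -> (\int[P]_w (N k w)%:E < +oo)%E.
  move=> k1; have GT := @sub_sigma_setT _ _ (filtration_gen Yt M k.-1).
  apply: le_lt_trans (_ : (((0 + (1 + l) * 1) / 1)%:E * P setT < +oo)%E).
    apply: (@integral_self_bounded_le _ _ _ P setT (N k) (cst 1%E) 1 0 1) => //.
    - exact: mN2.
    - by apply: aeW => w _; rewrite mul0r add0e mul1e lee_fin lerDl ler01.
    - rewrite (eq_integral (cst 1%E)).
        by rewrite integral_cst// expr1n.
      by move=> w _; rewrite mule1 expe2 mule1.
    - exact: (integral_le_of_cond_exp_le (Cm k.-1) (Nver k k1) l20 (hlk k k1) GT).
  by rewrite probability_setT mule1 ltry.
have NZ k : (1 <= k)%N -> is_cond_exp P <<s filtration_gen Yt M k.-1>>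
    (fun w => (N k w)%:E)
    (cond_exp P <<s filtration_gen Yt M k.-1>> (fun w => (N k w)%:E)).
  move=> k1; have [|||Z] :=
    @cond_exp_exists _ _ _ P _ (Cm k.-1) (fun w => (N k w)%:E).
  - exact: mN.
  - by move=> w; rewrite lee_fin.
  - exact: intN.
  exact: cond_exp_version.
have cond_bound k : (1 <= k)%N -> {ae P, forall w,
    (cond_exp P <<s filtration_gen Yt M k.-1>> (fun w' => (N k w')%:E) w
     <= (K / Num.sqrt (M k w)%:R)%:E)%E}.
  move=> k1; apply: (cond_exp_le_on_atoms (b := fun m => K / Num.sqrt m%:R)
    (Cm k.-1) (NZ k k1) (RA_Mmeas hRA k1)).
    by move=> m; rewrite divr_ge0// sqrtr_ge0.
  by move=> m A; exact: localN.
split.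
  move=> k k1; move: (cond_bound k k1); apply: filterS => w.
  by rewrite -mulrDl addrA.
move=> c1 C1 c1_gt1 hC1.
have c10 : 0 < c1 by exact: lt_trans c1_gt1.
pose r k := (Num.sqrt c1)^-1 ^+ k.-1 * (K / Num.sqrt m1%:R).
have m10 := RA_m1 hRA.
have growth k : (1 <= k)%N ->
    {ae P, forall w, c1 ^+ k.-1 * m1%:R <= (M k w)%:R :> R}.
  elim: k => // -[_ _|k IHk _].
    by apply: aeW => w; rewrite expr0 mul1r (RA_M1 hRA).
  have [_ h1 h2] := hC1 k.+2 isT.
  move: (IHk isT) h1 h2; apply: filterS3 => w /= IH h1 ->.
  by rewrite exprS -mulrA ler_pM// ?mulr_ge0 ?exprn_ge0 ?ler0n ?(ltW c10).
have decay k : (1 <= k)%N -> {ae P, forall w,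
    (cond_exp P <<s filtration_gen Yt M k.-1>> (fun w' => (N k w')%:E) w
     <= (r k)%:E)%E}.
  move=> k1; move: (cond_bound k k1) (growth k k1); apply: filterS2 => w + cM.
  move=> /le_trans; apply; rewrite lee_fin /r mulrCA ler_wpM2l//.
  rewrite exprVn -invfM lef_pV2 ?posrE; last 2 first.
  - by rewrite sqrtr_gt0 ltr0n (RA_Mpos hRA).
  - by rewrite mulr_gt0 ?exprn_gt0 ?sqrtr_gt0 ?ltr0n.
  rewrite -ler_sqr ?nnegrE ?mulr_ge0 ?exprn_ge0 ?sqrtr_ge0//.
  by rewrite exprMn -exprM mulnC exprM !sqr_sqrtr ?ler0n ?(ltW c10).
split.
  move=> k k1; have r0 : 0 <= r k.
    by rewrite mulr_ge0 ?exprn_ge0 ?invr_ge0 ?divr_ge0 ?sqrtr_ge0.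
  have GT := @sub_sigma_setT _ _ (filtration_gen Yt M k.-1).
  have := integral_le_of_cond_exp_le (Cm k.-1) (NZ k k1) r0 (decay k k1) GT.
  by rewrite probability_setT mule1.
move=> e k e0 k1 hk; move: (decay k k1); apply: filterS => w /le_trans; apply.
rewrite lee_fin.
by apply: geometric_decay_le => //; rewrite divr_ge0 ?sqrtr_ge0.
Qed.
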